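(* Let $\alpha\in(0,1]$, let $n\ge 1$ be an integer, let $p_0,p_1,\dots,p_{n-1}$ be real constants, and consider the homogeneous equation $${}^nT_\alpha y+p_{n-1}\,{}^{n-1}T_\alpha y+\cdots+p_2\,{}^2T_\alpha y+p_1T_\alpha y+p_0y=0 \qquad (t>0),$$ with characteristic equation $P_n(r)=r^n+p_{n-1}r^{n-1}+\cdots+p_0=0$. Let $\{r_j\}_{j=1}^k$ be $k$ distinct roots of the characteristic equation, of multiplicities $\{\mu_j\}_{j=1}^k$, and let $\{\lambda_j,\bar\lambda_j\}_{j=1}^p$, with $\lambda_j=\theta_j+i\beta_j$ ($\theta_j,\beta_j\in\mathbb{R}$, $\beta_j\neq 0$), be $2p$ distinct roots of the characteristic equation, of multiplicities $\{\sigma_j\}_{j=1}^p$ (both $\lambda_j$ and $\bar\lambda_j$ having multiplicity $\sigma_j$), such that $\sum_{j=1}^k\mu_j+2\sum_{j=1}^p\sigma_j=n$. Then the union of the following three sets of functions of $t>0$ is a linearly independent set of solutions of the homogeneous equation: $$\bigcup_{m=1}^{k}\left\{\left(\frac{t^\alpha}{\alpha}\right)^l e^{\frac{r_m}{\alpha}t^\alpha}\right\}_{l=0}^{\mu_m-1},$$ $$\bigcup_{m=1}^{p}\left\{\left(\frac{t^\alpha}{\alpha}\right)^l e^{\frac{\theta_m}{\alpha}t^\alpha}\left[\cos\left(\frac{\beta_m}{\alpha}t^\alpha\right)+i\sin\left(\frac{\beta_m}{\alpha}t^\alpha\right)\right]\right\}_{l=0}^{\sigma_m-1},$$ $$\bigcup_{m=1}^{p}\left\{\left(\frac{t^\alpha}{\alpha}\right)^l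 e^{\frac{\theta_m}{\alpha}t^\alpha}\left[\cos\left(\frac{\beta_m}{\alpha}t^\alpha\right)-i\sin\left(\frac{\beta_m}{\alpha}t^\alpha\right)\right]\right\}_{l=0}^{\sigma_m-1}.$$
   Context: For $\alpha\in(0,1]$ and a (real- or complex-valued) function $f$ on $(0,\infty)$, the conformable fractional derivative of order $\alpha$ at $t>0$ is $T_\alpha f(t)=f^{(\alpha)}(t)=\lim_{\varepsilon\to0}\frac{f(t+\varepsilon t^{1-\alpha})-f(t)}{\varepsilon}$, when the limit exists. ${}^jT_\alpha=T_\alpha T_\alpha\cdots T_\alpha$ ($j$ times) denotes the sequential (iterated) derivative. A solution is an $n$ times $\alpha$-differentiable function on $(0,\infty)$ satisfying the equation for all $t>0$. Since the functions may be complex-valued, linear independence is that of functions on $(0,\infty)$ over $\mathbb{C}$. *)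

(* Defs.v *)
From HB Require Import structures.
From mathcomp Require Import all_boot all_order all_algebra.
From mathcomp Require Import complex.
From mathcomp Require Import all_classical all_reals all_analysis.

Set Implicit Arguments.
Unset Strict Implicit.
Unset Printing Implicit Defensive.

Import Order.TTheory GRing.Theory Num.Theory.
Import numFieldNormedType.Exports.

Local Open Scope classical_set_scope.
Local Open Scope ring_scope.
Local Open Scope complex_scope.

(* Functions on ]0, +oo[ are total functions R -> R[i]; their values outside
   ]0, +oo[ are never used. *)

Definition cexp (R : realType) (z : R[i]) : R[i] :=
  (expR (complex.Re z))%:C *
  ((cos (complex.Im z))%:C + 'i * (sin (complex.Im z))%:C).

Section Conformable.
Variables (R : realType) (alpha : R).
Implicit Types (f y : R -> R[i]) (t : R).

(* The codomain is R[i]^o because the library declares the topology given by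
   the modulus on the regular algebra of a numFieldType, not on R[i]. *)
Definition conf_quotient f t (eps : R) : R[i]^o :=
  (f (t + eps * t `^ (1 - alpha)) - f t) / eps%:C.

Definition conf_derivable f t : Prop := cvg (conf_quotient f t @ 0^').

(* Meaningful only where [conf_derivable f t] holds. *)
Definition conf_derive f : R -> R[i] :=
  fun t => lim (conf_quotient f t @ 0^').

Definition conf_derive_n (j : nat) f : R -> R[i] := iter j conf_derive f.

Definition n_conf_derivable (n : nat) f : Prop :=
  forall j, (j < n)%N -> forall t, 0 < t ->
    conf_derivable (conf_derive_n j f) t.

Definition is_solution (n : nat) (p : 'I_n -> R) y : Prop :=
  n_conf_derivable n y /\
  forall t, 0 < t ->
    conf_derive_n n y t + \sum_(j < n) (p j)%:C * conf_derive_n j y t = 0.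

End Conformable.

Definition char_poly_of (R : realType) (n : nat) (p : 'I_n -> R) :
    {poly R[i]} :=
  'X^n + \sum_(j < n) ((p j)%:C)%:P * 'X^j.

(* [mup r P], the largest m such that ('X - r)^m divides P, is only used
   for P != 0. *)
Definition root_of_mult (R : realType) (P : {poly R[i]}) (r : R[i])
    (m : nat) : Prop :=
  root P r /\ mup r P = m.

(* Linear independence over R[i] of a set of functions on ]0, +oo[: two
   functions are distinct when they differ at some t > 0. *)
Definition lin_indep_set (R : realType) (S : set (R -> R[i])) : Prop :=
  forall (N : nat) (f : 'I_N -> R -> R[i]) (c : 'I_N -> R[i]),
    (forall i, S (f i)) ->
    (forall i j, i != j -> exists2 t, 0 < t & f i t != f j t) ->
    (forall t, 0 < t -> \sum_(i < N) c i * f i t = 0) ->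
    forall i, c i = 0.

Section Families.
Variables (R : realType) (alpha : R).

Definition exp_family (k : nat) (r : 'I_k -> R[i]) (mu : 'I_k -> nat) :
    set (R -> R[i]) :=
  \bigcup_(m in [set: 'I_k])
    [set (fun t : R => ((t `^ alpha / alpha) ^+ l)%:C *
                       cexp (r m / alpha%:C * (t `^ alpha)%:C))
       | l in [set l | (l < mu m)%N]].

Definition trig_family_plus (q : nat) (theta beta : 'I_q -> R)
    (sigma : 'I_q -> nat) : set (R -> R[i]) :=
  \bigcup_(m in [set: 'I_q])
    [set (fun t : R => ((t `^ alpha / alpha) ^+ l)%:C *
                       (expR (theta m / alpha * t `^ alpha))%:C *
                       ((cos (beta m / alpha * t `^ alpha))%:C
                        + 'i * (sin (beta m / alpha * t `^ alpha))%:C))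
       | l in [set l | (l < sigma m)%N]].

Definition trig_family_minus (q : nat) (theta beta : 'I_q -> R)
    (sigma : 'I_q -> nat) : set (R -> R[i]) :=
  \bigcup_(m in [set: 'I_q])
    [set (fun t : R => ((t `^ alpha / alpha) ^+ l)%:C *
                       (expR (theta m / alpha * t `^ alpha))%:C *
                       ((cos (beta m / alpha * t `^ alpha))%:C
                        - 'i * (sin (beta m / alpha * t `^ alpha))%:C))
       | l in [set l | (l < sigma m)%N]].

End Families.

(* Main.v *)
Require Import Defs.
From HB Require Import structures.
From mathcomp Require Import all_boot all_order all_algebra.
From mathcomp Require Import complex.
From mathcomp Require Import all_classical all_reals all_analysis.
From mathcomp Require Import ring lra.

Set Implicit Arguments.
Unset Strict Implicit.
Unset Printing Implicit Defensive.

Import Order.TTheory GRing.Theory Num.Theory.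
Import numFieldNormedType.Exports.

Local Open Scope classical_set_scope.
Local Open Scope ring_scope.
Local Open Scope complex_scope.

(** With u = t^alpha / alpha, the operator T_alpha is d/du, so everything is a
    matter of quasi-polynomials Q(u) e^(rho u).

    For a polynomial Q put [twist rho Q] = Q' + rho Q.  Then T_alpha maps
    Q(u) e^(rho u) to (twist rho Q)(u) e^(rho u)
    ([is_conf_derive_quasipoly]), and both claims become claims on
    polynomials.

    Each function of the three families is u^l e^(rho u) for a root rho of the
    characteristic polynomial P and an l smaller than its multiplicity m.  If
    (X - rho)^m divides P and Q has degree less than m, then
    P(twist rho) Q = 0, because twist rho - rho is the ordinary derivative and
    its m-th power kills Q ([twist_poly_eq0]).  Hence such a function is a
    solution ([quasipoly_is_solution]).

    For independence, let a sum of Q_rho(u) e^(rho u) over distinct rho vanish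
    for all t > 0.  Applying (T_alpha - rho0)^N with N at least the size of
    Q_rho0 removes the rho0 term and replaces every other Q_rho by
    (twist (rho - rho0))^N Q_rho, which is zero only if Q_rho is.  By induction
    on the number of exponents all Q_rho vanish ([quasipoly_indep]).  Grouping
    by exponent, a linear relation between pairwise distinct functions
    u^l e^(rho u) has zero coefficients ([quasimonomial_indep]). *)

(** * The operator Q |-> Q' + rho Q on polynomials *)

Section Twist.
Variable F : fieldType.
Implicit Types (P Q : {poly F}) (rho : F).

(** The conjugate of the derivation by the exponential: formally
    (Q e^(rho X))' = (twist rho Q) e^(rho X). *)
Definition twist rho Q := Q^`() + rho *: Q.

Lemma twist_is_linear rho : linear (twist rho).
Proof.
by move=> a P Q; rewrite /twist linearP /= !scalerDr !scalerA mulrC addrACA.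
Qed.

HB.instance Definition _ rho :=
  GRing.isLinear.Build F {poly F} {poly F} _ (twist rho) (twist_is_linear rho).

Lemma twistB rho rho0 Q : twist rho Q - rho0 *: Q = twist (rho - rho0) Q.
Proof. by rewrite /twist -addrA -scalerBl. Qed.

Lemma size_twist rho Q : rho != 0 -> size (twist rho Q) = size Q.
Proof.
move=> rho0; rewrite /twist; have [->|Q0] := eqVneq Q 0.
  by rewrite linear0 scaler0 addr0.
by rewrite addrC size_polyDl size_scale // lt_size_deriv.
Qed.

Lemma size_twist0 Q : (size (twist 0 Q) <= (size Q).-1)%N.
Proof.
rewrite /twist scale0r addr0; have [->|Q0] := eqVneq Q 0.
  by rewrite linear0 size_poly0.
by rewrite -ltnS prednK ?size_poly_gt0 // lt_size_deriv.
Qed.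

Lemma iter_twist0 Q N : (size Q <= N)%N -> iter N (twist 0) Q = 0.
Proof.
elim: N Q => [|N IH] Q; first by rewrite leqn0 size_poly_eq0 => /eqP.
move=> sQ; rewrite iterSr IH //; apply: leq_trans (size_twist0 Q) _.
by case: (size Q) sQ.
Qed.

Lemma iter_twist_eq0 rho N Q : rho != 0 -> iter N (twist rho) Q = 0 -> Q = 0.
Proof.
move=> rho0; elim: N => //= N IH /eqP.
by rewrite -size_poly_eq0 size_twist // size_poly_eq0 => /eqP.
Qed.

(** P(twist rho) Q = 0 when rho is a root of P of multiplicity at least the size
    of Q.  The bound N, which need not be the size of P, lets the induction on m
    drop one coefficient when a factor X - rho is removed. *)
Lemma twist_poly_eq0 rho P Q m N :
  ('X - rho%:P) ^+ m %| P -> (size Q <= m)%N ->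
  (size P <= N)%N -> \sum_(i < N) P`_i *: iter i (twist rho) Q = 0.
Proof.
elim: m P Q N => [|m IH] P Q N.
  move=> _; rewrite leqn0 size_poly_eq0 => /eqP -> _; apply: big1 => i _.
  rewrite (_ : iter i _ 0 = 0) ?scaler0 //.
  by elim: (nat_of_ord i) => //= j ->; rewrite linear0.
case/dvdpP=> P1 ->{P} sQ; rewrite exprSr mulrA.
set P := P1 * _; have PP : ('X - rho%:P) ^+ m %| P by rewrite dvdp_mull.
rewrite mulrBr mulrC -/P.
have itl i a P' Q' : iter i (twist rho) (a *: P' + Q') =
    a *: iter i (twist rho) P' + iter i (twist rho) Q'.
  by elim: i => //= i ->; rewrite linearP.
case: N => [|N] sP; first by rewrite big_ord0.
have sPN : (size P <= N)%N.
  have [->|P0] := eqVneq P 0; first by rewrite size_poly0.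
  move: sP; rewrite -mulrC -mulrBr size_Mmonic ?monicXsubC // size_XsubC.
  by rewrite addnC.
have sQ' : (size Q^`() <= m)%N.
  have [->|Q0] := eqVneq Q 0; first by rewrite linear0 size_poly0.
  by rewrite -ltnS (leq_trans (lt_size_deriv Q0)).
rewrite -[RHS](IH P _ N PP sQ' sPN).
(* the sum for ('X - rho) * P and Q is the sum for P and
   twist rho Q - rho *: Q = Q^`() *)
under eq_bigr do rewrite coefB coefXM coefMC scalerBl.
rewrite sumrB big_ord_recl /= scale0r add0r.
rewrite [X in _ - X]big_ord_recr /= [P`_N]nth_default // mul0r scale0r addr0.
rewrite -sumrB; apply: eq_bigr => i _.
rewrite -scalerA -scalerBr; congr (_ *: _).
by rewrite -iterS iterSr addrC -scaleNr -itl /twist scaleNr addrCA addNr addr0.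
Qed.

End Twist.

(** * Rules for the conformable derivative *)

Section ConformableRules.
Variables (R : realType) (alpha : R).
Implicit Types (f g : R -> R[i]) (t : R).

(** [f] has the conformable derivative [l] at [t]. *)
Definition is_conf_derive f t (l : R[i]) : Prop :=
  conf_quotient alpha f t @ 0^' --> (l : R[i]^o).

Lemma cvg_real_complex T (F : set_system T) (FF : Filter F) (g : T -> R)
    (l : R) :
  g @ F --> l -> ((fun x => (g x)%:C : R[i]^o) @ F) --> ((l%:C) : R[i]^o).
Proof.
move=> gl; apply/cvgrPdist_lt => e e0.
(* a positive complex number is a real one *)
have [e1 e1_gt0 -> {e e0}] : exists2 e1 : R, 0 < e1 & e = e1%:C.
  by move: e0; case: e => a b; rewrite ltcE /= => /andP[/eqP -> a0]; exists a.
move/cvgrPdist_lt: gl => /(_ e1 e1_gt0); apply: filterS => x.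
by rewrite -rmorphB /= normc_def /= expr0n addr0 sqrtr_sqr ltcR.
Qed.

Lemma is_conf_derive_conf_derivable f t l :
  is_conf_derive f t l -> conf_derivable alpha f t.
Proof. by move=> h; apply/cvg_ex; exists l. Qed.

Lemma is_conf_deriveE f t l : is_conf_derive f t l -> conf_derive alpha f t = l.
Proof. by move=> h; exact: (@cvg_lim R[i]^o (@norm_hausdorff _ _)). Qed.

Lemma near_pos_shift t (c : R) :
  0 < t -> \forall e \near (0 : R)^', 0 < t + e * c.
Proof.
have [->|c0] := eqVneq c 0.
  by move=> t0; apply: nearW => e; rewrite mulr0 addr0.
move=> t0; have h : 0 < t / `|c| by rewrite divr_gt0 ?normr_gt0.
have := @dnbhs0_lt R R^o _ h; apply: filterS => e.
rewrite ltr_pdivlMr ?normr_gt0 // -normrM ltr_norml => /andP[+ _]; lra.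
Qed.

(** The conformable derivative at [t > 0] only depends on the values at positive
    arguments. *)
Lemma is_conf_derive_ext f g t l : 0 < t -> (forall s, 0 < s -> f s = g s) ->
  is_conf_derive f t l -> is_conf_derive g t l.
Proof.
move=> t0 fg; apply: cvg_trans; apply: near_eq_cvg.
have := near_pos_shift (t `^ (1 - alpha)) t0; apply: filterS => e e0.
by rewrite /conf_quotient !fg.
Qed.

Lemma is_conf_derive_cst (c : R[i]) t : is_conf_derive (fun=> c) t 0.
Proof.
rewrite /is_conf_derive /conf_quotient.
under eq_fun do rewrite subrr mul0r.
exact: cvg_cst.
Qed.

Lemma is_conf_deriveD f g t l m :
  is_conf_derive f t l -> is_conf_derive g t m ->
  is_conf_derive (fun s => f s + g s) t (l + m).
Proof.
move=> hf hg; apply: cvg_trans (cvgD hf hg); apply: near_eq_cvg.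
by apply: nearW => e; rewrite /conf_quotient /= -mulrDl opprD addrACA.
Qed.

Lemma is_conf_derive_cvg f t l : is_conf_derive f t l ->
  ((fun e => f (t + e * t `^ (1 - alpha)) : R[i]^o) @ 0^') --> (f t : R[i]^o).
Proof.
move=> hf.
have he : ((fun e : R => e%:C : R[i]^o) @ 0^') --> (0 : R[i]^o).
  apply: (@cvg_real_complex R (0^') _ id 0) => A hA.
  exact: (@nbhs_dnbhs R 0 A hA).
rewrite -[X in _ --> X]add0r -(mulr0 (l : R[i]^o)).
apply: cvg_trans (cvgD (cvgM hf he) (cvg_cst (f t : R[i]^o))).
apply: near_eq_cvg.
have := @nbhs_dnbhs_neq R 0; apply: filterS => e e0.
rewrite -[LHS]/((f (t + e * t `^ (1 - alpha)) - f t) / e%:C * e%:C + f t).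
by rewrite divfK ?subrK // fmorph_eq0.
Qed.

Lemma is_conf_deriveM f g t l m :
  is_conf_derive f t l -> is_conf_derive g t m ->
  is_conf_derive (fun s => f s * g s) t (l * g t + f t * m).
Proof.
move=> hf hg; apply: cvg_trans (cvgD (cvgM hf (cvg_cst (g t : R[i]^o)))
  (cvgM (is_conf_derive_cvg hf) hg)); apply: near_eq_cvg.
apply: nearW => e; rewrite /conf_quotient /=.
set a := f (t + _); set b := g (t + _).
rewrite -[LHS]/((a - f t) / e%:C * g t + a * ((b - g t) / e%:C)). ring.
Qed.

(** T_alpha h (t) = t^(1 - alpha) h'(t) for a real function [h]. *)
Lemma is_conf_derive_real (h : R -> R) t d : is_derive t 1 h d ->
  is_conf_derive (fun s => (h s)%:C) t (t `^ (1 - alpha) * d)%:C.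
Proof.
move=> hd; set c := t `^ _.
have hs : is_derive (0 : R) 1 (fun e : R => t + e * c) c.
  by apply: is_derive_eq; rewrite scaler0 !add0r mul1r [_%:A]mulr1.
have hd' : is_derive (t + 0 * c) 1 h d by rewrite mul0r addr0.
have [hx hv] := @is_derive1_comp R h (fun e => t + e * c) 0 d c hd' hs.
rewrite mulrC.
apply: cvg_trans
  (cvg_real_complex _ (eq_ind _ (fun l => _ --> l) hx _ hv)).
apply: near_eq_cvg; apply: nearW => e.
rewrite /conf_quotient /= mul0r !addr0 [_%:A]mulr1 -/c.
rewrite -[LHS]/((e^-1 * (h (t + e * c) - h t))%:C).
by rewrite rmorphM rmorphB fmorphV mulrC.
Qed.

(** The variable u = t^alpha / alpha, for which T_alpha is d/du. *)
Definition conf_var t : R := t `^ alpha / alpha.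

Hypothesis alpha_gt0 : 0 < alpha.

Lemma is_conf_derive_comp_conf_var (h : R -> R) t d : 0 < t ->
  is_derive (conf_var t) 1 h d ->
  is_conf_derive (fun s => (h (conf_var s))%:C) t d%:C.
Proof.
move=> t0 hd.
have hu : is_derive t 1 conf_var (t `^ (alpha - 1)).
  apply: (@is_derive_eq _ _ _ _ _ _ _
    (alpha^-1 *: (alpha * t `^ (alpha - 1)))); last first.
    by rewrite -[LHS]/(_ * _) mulKf // gt_eqF.
  have -> : conf_var = alpha^-1 \*: (fun s : R => s `^ alpha).
    by apply/funext => s; rewrite /conf_var mulrC.
  by apply: is_deriveZ; exact: is_derive1_powR.
suff -> : d%:C = (t `^ (1 - alpha) * (d * t `^ (alpha - 1)))%:C.
  by apply: is_conf_derive_real; apply: is_derive1_comp.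
congr _%:C; rewrite mulrCA -powRD; last by rewrite (gt_eqF t0) implybT.
by rewrite addrA subrK subrr powRr0 mulr1.
Qed.

(** The quasi-polynomial t |-> Q(u) e^(rho u) with u = [conf_var t]. *)
Definition quasipoly (Q : {poly R[i]}) (rho : R[i]) t : R[i] :=
  Q.[(conf_var t)%:C] * cexp (rho * (conf_var t)%:C).

Lemma is_conf_derive_cexp rho t : 0 < t ->
  is_conf_derive (fun s => cexp (rho * (conf_var s)%:C)) t
    (rho * cexp (rho * (conf_var t)%:C)).
Proof.
case: rho => a b t0.
have E s : cexp ((a +i* b) * (conf_var s)%:C) = (expR (a * conf_var s))%:C *
  ((cos (b * conf_var s))%:C + 'i * (sin (b * conf_var s))%:C).
  by rewrite /cexp /= !(mulr0, mul0r) subr0 add0r.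
rewrite (_ : (fun s => _) = (fun s => (expR (a * conf_var s))%:C *
  ((cos (b * conf_var s))%:C + 'i * (sin (b * conf_var s))%:C)));
  last exact/funext.
have aff (c : R) : is_derive (conf_var t) 1 ( *%R c) c.
  by apply: is_derive_eq; rewrite [_%:A]mulr1.
have he := is_conf_derive_comp_conf_var t0
  (is_derive1_comp (is_derive_expR _) (aff a)).
have hc := is_conf_derive_comp_conf_var t0
  (is_derive1_comp (is_derive_cos _) (aff b)).
have hs := is_conf_derive_comp_conf_var t0
  (is_derive1_comp (is_derive_sin _) (aff b)).
have := is_conf_deriveM he
  (is_conf_deriveD hc (is_conf_deriveM (is_conf_derive_cst 'i t) hs)).
rewrite /= E; congr is_conf_derive.
rewrite mul0r add0r.
have -> : a +i* b = a%:C + 'i * b%:C :> R[i].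
  exact: (complexE (a +i* b)).
rewrite rmorphM /= rmorphM /= rmorphM /= rmorphN /=.
rewrite complexiE; have i2 : 'i * 'i = -1 :> R[i] := mulCii _.
by ring: i2.
Qed.

Lemma is_conf_derive_horner Q t : 0 < t ->
  is_conf_derive (fun s => Q.[(conf_var s)%:C]) t Q^`().[(conf_var t)%:C].
Proof.
move=> t0; elim/poly_ind: Q => [|Q c IH].
  under eq_fun do rewrite horner0.
  rewrite linear0 horner0; exact: is_conf_derive_cst.
have hu := is_conf_derive_comp_conf_var t0 (is_derive_id (conf_var t) 1).
have := is_conf_deriveD (is_conf_deriveM IH hu) (is_conf_derive_cst c t).
rewrite derivD derivC addr0 derivM derivX !mulr1 addr0 hornerD hornerM hornerX.
congr is_conf_derive; apply/funext => s; by rewrite /= hornerMXaddC.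
Qed.

Lemma is_conf_derive_quasipoly Q rho t : 0 < t ->
  is_conf_derive (quasipoly Q rho) t (quasipoly (twist rho Q) rho t).
Proof.
move=> t0.
have := is_conf_deriveM
  (@is_conf_derive_horner Q t t0) (@is_conf_derive_cexp rho t t0).
congr is_conf_derive; rewrite /quasipoly /twist hornerD hornerZ; ring.
Qed.

Lemma is_conf_derive_sum (I : Type) (s : seq I) (F : I -> R -> R[i])
    (l : I -> R[i]) t :
  (forall i, is_conf_derive (F i) t (l i)) ->
  is_conf_derive (fun x => \sum_(i <- s) F i x) t (\sum_(i <- s) l i).
Proof.
move=> h; elim: s => [|i s IH].
  rewrite big_nil; under eq_fun do rewrite big_nil.
  exact: is_conf_derive_cst.
rewrite big_cons; under eq_fun do rewrite big_cons.
exact: is_conf_deriveD.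
Qed.

Lemma conf_derive_n_quasipoly j Q rho t : 0 < t ->
  conf_derive_n alpha j (quasipoly Q rho) t =
  quasipoly (iter j (twist rho) Q) rho t.
Proof.
elim: j t => //= j IH t t0; apply: is_conf_deriveE.
apply: (@is_conf_derive_ext (quasipoly (iter j (twist rho) Q) rho))
  => // [s s0|].
  by rewrite IH.
exact: is_conf_derive_quasipoly.
Qed.

Lemma quasipoly_n_derivable n Q rho :
  n_conf_derivable alpha n (quasipoly Q rho).
Proof.
move=> j _ t t0; apply: (@is_conf_derive_conf_derivable _ _
  (quasipoly (iter j.+1 (twist rho) Q) rho t)).
apply: (@is_conf_derive_ext (quasipoly (iter j (twist rho) Q) rho))
  => // [s s0|].
  by rewrite conf_derive_n_quasipoly.
exact: is_conf_derive_quasipoly.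
Qed.

(** * Linear independence of quasi-monomials *)

Lemma conf_var_surj u : 0 < u -> exists2 t, 0 < t & conf_var t = u.
Proof.
move=> u0; exists ((alpha * u) `^ alpha^-1).
  by rewrite powR_gt0 // mulr_gt0.
rewrite /conf_var -powRrM mulVf ?gt_eqF // powRr1 ?mulr_ge0 ?ltW //.
by rewrite mulrAC divff ?mul1r // gt_eqF.
Qed.

Lemma cexp_neq0 (z : R[i]) : cexp z != 0.
Proof.
rewrite mulf_neq0 //; first by rewrite fmorph_eq0 gt_eqF // expR_gt0.
case: z => a b /=; apply/eqP => /eqP; rewrite -complexiE.
rewrite eq_complex /= !(mulr0, mul0r, mul1r, addr0, add0r, subr0).
case/andP=> /eqP c0 /eqP s0; have := cos2Dsin2 b.
by rewrite c0 s0 expr0n /= addr0 => /eqP; rewrite eq_sym oner_eq0.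
Qed.

Lemma poly_eq0_pos (Q : {poly R[i]}) :
  (forall u : R, 0 < u -> Q.[u%:C] = 0) -> Q = 0.
Proof.
move=> h; apply/eqP; apply: contraT => Q0.
(* the size of Q many positive integers are roots of Q *)
have := @max_poly_roots _ Q [seq (i.+1%:R : R)%:C | i <- iota 0 (size Q)] Q0.
rewrite size_map size_iota ltnn => -> //.
  by apply/allP => _ /mapP[i _ ->]; apply/rootP/h.
rewrite map_inj_uniq ?iota_uniq // => i j /(fmorph_inj _) /eqP.
by rewrite eqr_nat => /eqP[].
Qed.

(** The exponentials e^(rho u) with distinct rho are linearly independent over
    the polynomials in u. *)
Lemma quasipoly_indep (rs : seq R[i]) (Q : R[i] -> {poly R[i]}) : uniq rs ->
  (forall t, 0 < t -> \sum_(rho <- rs) quasipoly (Q rho) rho t = 0) ->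
  forall rho, rho \in rs -> Q rho = 0.
Proof.
elim: rs Q => [//|rho0 rs IH] Q /= /andP[rs0 urs] sum0.
(* (T_alpha - rho0)^N maps Q(u) e^(rho u) to (QN N rho)(u) e^(rho u). *)
pose QN N rho := iter N (twist (rho - rho0)) (Q rho).
have sumN N t : 0 < t ->
    \sum_(rho <- rho0 :: rs) quasipoly (QN N rho) rho t = 0.
  elim: N t => [|N IHN] t t0; first exact: sum0.
  have h1 : is_conf_derive
      (fun s => \sum_(rho <- rho0 :: rs) quasipoly (QN N rho) rho s) t
      (\sum_(rho <- rho0 :: rs) quasipoly (twist rho (QN N rho)) rho t).
    by apply: is_conf_derive_sum => rho; exact: is_conf_derive_quasipoly.
  have h2 := is_conf_derive_ext t0 IHN h1.
  have h3 := is_conf_deriveE h2.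
  rewrite (is_conf_deriveE (is_conf_derive_cst 0 t)) in h3.
  transitivity (
      \sum_(rho <- rho0 :: rs) quasipoly (twist rho (QN N rho)) rho t
      - rho0 * \sum_(rho <- rho0 :: rs) quasipoly (QN N rho) rho t).
    rewrite mulr_sumr -sumrB; apply: eq_bigr => rho _.
    rewrite [QN _ _]iterS -twistB /quasipoly hornerD hornerN hornerZ; ring.
  by rewrite IHN // mulr0 subr0 -h3.
have Qrs rho : rho \in rs -> Q rho = 0.
  move=> rrs; have rr0 : rho - rho0 != 0.
    by rewrite subr_eq0; apply: contraNneq rs0 => <-.
  apply: (@iter_twist_eq0 _ _ (size (Q rho0)) _ rr0).
  apply: (IH (QN (size (Q rho0)))) => // t t0.
  have := sumN (size (Q rho0)) t t0; rewrite big_cons.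
  by rewrite {1}/QN subrr iter_twist0 // /quasipoly horner0 mul0r add0r.
move=> rho; rewrite inE => /orP[/eqP->|]; last exact: Qrs.
apply: poly_eq0_pos => u /conf_var_surj[t t0 <-].
have := sum0 t t0; rewrite big_cons big_seq big1 => [|rho1 /Qrs ->]; last first.
  by rewrite /quasipoly horner0 mul0r.
by rewrite addr0 => /eqP; rewrite mulf_eq0 (negPf (cexp_neq0 _)) orbF => /eqP.
Qed.

(** The pairs (l i, rho i) are not assumed distinct: this follows from the
    functions being distinct on ]0, +oo[. *)
Lemma quasimonomial_indep N (f : 'I_N -> R -> R[i]) (c : 'I_N -> R[i])
    (l : 'I_N -> nat) (rho : 'I_N -> R[i]) :
  (forall i t, 0 < t -> f i t = quasipoly 'X^(l i) (rho i) t) ->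
  (forall i j, i != j -> exists2 t, 0 < t & f i t != f j t) ->
  (forall t, 0 < t -> \sum_(i < N) c i * f i t = 0) ->
  forall i, c i = 0.
Proof.
move=> fE fD sum0 i.
have inj j : rho j = rho i -> l j = l i -> j = i.
  move=> er el; apply/eqP; apply: contraT => /fD[t t0].
  by rewrite !fE // er el eqxx.
(* Q z is the polynomial factor of e^(z u) in the relation. *)
pose Q z := \sum_(j < N | rho j == z) c j *: 'X^(l j) : {poly R[i]}.
have Qi : Q (rho i) = 0.
  apply: (@quasipoly_indep (undup (codom rho)));
    rewrite ?undup_uniq //; last first.
    by rewrite mem_undup codom_f.
  move=> t t0; rewrite -[RHS](sum0 t t0).
  transitivity (\sum_(z <- undup (codom rho))
      \sum_(j < N | rho j == z) c j * f j t).
    apply: eq_bigr => z _; rewrite /quasipoly /Q horner_sum mulr_suml.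
    by apply: eq_bigr => j /eqP ez; rewrite fE // hornerZ /quasipoly ez -mulrA.
  rewrite (exchange_big_dep xpredT) //=; apply: eq_bigr => j _.
  rewrite -big_filter (_ : [seq z <- _ | _] = [:: rho j]) ?big_seq1 //.
  rewrite (eq_filter (a2 := pred1 (rho j))) => [|z]; last by rewrite /= eq_sym.
  by rewrite filter_pred1_uniq ?undup_uniq // mem_undup codom_f.
have := congr1 (fun P : {poly R[i]} => P`_(l i)) Qi.
rewrite coef0 coef_sum (bigD1 i) //= coefZ coefXn eqxx mulr1 big1 ?addr0 //.
move=> j /andP[/eqP er ji]; rewrite coefZ coefXn [_ == _]negbTE ?mulr0 //.
by apply: contraNneq ji => el; apply/eqP/inj.
Qed.

End ConformableRules.

(** * Quasi-polynomial solutions of the equation *)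

Section CharPoly.
Variables (R : realType) (n : nat) (p : 'I_n -> R).

Lemma coef_char_poly_of (j : 'I_n) : (char_poly_of p)`_j = (p j)%:C.
Proof.
rewrite /char_poly_of coefD coefXn (ltn_eqF (ltn_ord j)) add0r coef_sum.
rewrite (bigD1 j) //= coefCM coefXn eqxx mulr1 big1 ?addr0 // => i ij.
by rewrite coefCM coefXn eq_sym (inj_eq val_inj) (negPf ij) mulr0.
Qed.

Lemma size_char_poly_of : size (char_poly_of p) = n.+1.
Proof.
rewrite /char_poly_of size_polyDl size_polyXn // ltnS.
apply: (leq_trans (size_sum _ _ _)); apply/bigmax_leqP => j _.
by rewrite mul_polyC (leq_trans (size_scale_leq _ _)) // size_polyXn.
Qed.

Lemma lead_char_poly_of : (char_poly_of p)`_n = 1.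
Proof.
rewrite /char_poly_of coefD coefXn eqxx coef_sum big1 ?addr0 // => j _.
by rewrite coefCM coefXn (gtn_eqF (ltn_ord j)) mulr0.
Qed.

Lemma char_poly_of_neq0 : char_poly_of p != 0.
Proof. by rewrite -size_poly_eq0 size_char_poly_of. Qed.

Lemma root_of_mult_dvdp (z : R[i]) m :
  root_of_mult (char_poly_of p) z m -> ('X - z%:P) ^+ m %| char_poly_of p.
Proof. by case=> _ <-; rewrite -mup_geq ?char_poly_of_neq0. Qed.

Lemma quasipoly_is_solution (alpha : R) (Q : {poly R[i]}) (rho : R[i]) m :
  0 < alpha -> ('X - rho%:P) ^+ m %| char_poly_of p -> (size Q <= m)%N ->
  is_solution alpha p (quasipoly alpha Q rho).
Proof.
move=> alpha0 dvdP sQ; split; first exact: quasipoly_n_derivable.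
move=> t t0; have := twist_poly_eq0 dvdP sQ (eq_leq size_char_poly_of).
rewrite big_ord_recr /= lead_char_poly_of scale1r addrC.
move=> /(congr1 (fun T => quasipoly alpha T rho t)).
rewrite [RHS]/quasipoly horner0 mul0r => sum0; rewrite -[RHS]sum0.
rewrite [RHS]/quasipoly hornerD mulrDl horner_sum mulr_suml.
congr (_ + _); first exact: conf_derive_n_quasipoly.
apply: eq_bigr => j _; rewrite conf_derive_n_quasipoly // hornerZ -mulrA.
by rewrite coef_char_poly_of.
Qed.

End CharPoly.

(** * The three families as quasi-monomials *)

Section Families.
Variables (R : realType) (alpha : R).

Lemma quasimonomialE l (rho : R[i]) t :
  quasipoly alpha 'X^l rho t =
  ((t `^ alpha / alpha) ^+ l)%:C * cexp (rho * (t `^ alpha / alpha)%:C).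
Proof. by rewrite /quasipoly hornerXn rmorphXn. Qed.

Lemma exp_familyP k (r : 'I_k -> R[i]) mu y : exp_family alpha r mu y ->
  exists m l, (l < mu m)%N /\ y = quasipoly alpha 'X^l (r m).
Proof.
case=> m _ [l /= lm <-]; exists m, l; split=> //; apply/funext => t.
rewrite quasimonomialE; congr (_ * cexp _).
by rewrite rmorphM /= fmorphV mulrA mulrAC.
Qed.

Lemma trig_family_plusP q (theta beta : 'I_q -> R) sigma y :
  trig_family_plus alpha theta beta sigma y ->
  exists m l, (l < sigma m)%N /\
    y = quasipoly alpha 'X^l (theta m +i* beta m).
Proof.
case=> m _ [l /= lm <-]; exists m, l; split=> //; apply/funext => t.
rewrite quasimonomialE /cexp /= !(mulr0, mul0r) subr0 add0r mulrA.
by rewrite !mulrA ![_ * _ / alpha]mulrAC.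
Qed.

Lemma trig_family_minusP q (theta beta : 'I_q -> R) sigma y :
  trig_family_minus alpha theta beta sigma y ->
  exists m l, (l < sigma m)%N /\
    y = quasipoly alpha 'X^l (theta m +i* beta m)^*.
Proof.
case=> m _ [l /= lm <-]; exists m, l; split=> //; apply/funext => t.
rewrite quasimonomialE /cexp /= !(mulr0, mul0r) subr0 add0r mulrA.
rewrite mulNr cosN sinN rmorphN mulrN.
by rewrite !mulrA ![_ * _ / alpha]mulrAC.
Qed.

End Families.

Theorem theorem3p1 (R : realType) (alpha : R)
  (alpha_gt0 : 0 < alpha) (alpha_le1 : alpha <= 1)
  (n : nat) (n_ge1 : (1 <= n)%N) (p : 'I_n -> R)
  (k : nat) (r : 'I_k -> R[i]) (mu : 'I_k -> nat)
  (r_inj : injective r)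
  (r_root : forall m, root_of_mult (char_poly_of p) (r m) (mu m))
  (q : nat) (theta beta : 'I_q -> R) (sigma : 'I_q -> nat)
  (beta_neq0 : forall m, beta m != 0)
  (lambda_distinct :
     uniq (codom (fun m => theta m +i* beta m) ++
           codom (fun m => (theta m +i* beta m)^*)))
  (lambda_root : forall m,
     root_of_mult (char_poly_of p) (theta m +i* beta m) (sigma m))
  (lambda_conj_root : forall m,
     root_of_mult (char_poly_of p) (theta m +i* beta m)^* (sigma m))
  (sum_mult : (\sum_(m < k) mu m + 2 * \sum_(m < q) sigma m = n)%N) :
  let S := exp_family alpha r mu `|` trig_family_plus alpha theta beta sigma
           `|` trig_family_minus alpha theta beta sigma in
  (forall y, S y -> is_solution alpha p y) /\ lin_indep_set S.
Proof.
move=> S.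
have SE y : S y -> exists l rho, y = quasipoly alpha 'X^l rho /\
    ('X - rho%:P) ^+ l.+1 %| char_poly_of p.
  have dvd (z : R[i]) m l : root_of_mult (char_poly_of p) z m -> (l < m)%N ->
      ('X - z%:P) ^+ l.+1 %| char_poly_of p.
    by move=> /root_of_mult_dvdp zm lm; apply: dvdp_trans zm; exact: dvdp_exp2l.
  move=> [[/exp_familyP|/trig_family_plusP]|/trig_family_minusP]
    [m [l [lm ->]]].
  - by exists l, (r m); split=> //; exact: dvd lm.
  - by exists l, (theta m +i* beta m); split=> //; exact: dvd lm.
  - by exists l, (theta m +i* beta m)^*; split=> //; exact: dvd lm.
split=> [y /SE[l [rho [-> dvdP]]]|N f c fS fD sum0].
  by apply: quasipoly_is_solution dvdP _; rewrite ?size_polyXn.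
have /choice[l /choice[rho fE]] : forall i, exists l rho,
    f i = quasipoly alpha 'X^l rho.
  by move=> i; have [l [rho [-> _]]] := SE _ (fS i); exists l, rho.
apply: (@quasimonomial_indep R alpha alpha_gt0 N f c l rho) => // i t _.
by rewrite fE.
Qed.
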